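(* Let $\mathbf{x}_1$ be the initial state, $v_1=0$, and let $\boldsymbol{\lambda}=(\lambda_t)_{t=1}^T$ range over collections of functions $\lambda_t:\mathcal{V}_t\to\mathbb{R}$. Then: 1. $L_1(\mathbf{x}_1,v_1;\boldsymbol{\lambda})\le J_1(\mathbf{x}_1)$ for all $\boldsymbol{\lambda}$. 2. $L_1(\mathbf{x}_1,v_1;\boldsymbol{\lambda})$ is a concave function of $\boldsymbol{\lambda}$.
   Context: There are $n$ generators and $T$ periods. Demand. $D_1=0$. For each $t$, $D_t$ takes values in a finite set $\mathcal{D}_t\subset\mathbb{R}$ (with $\mathcal{D}_1=\{0\}$). $(D_t)$ is a Markov process with $P_t(w\vert d)$ the probability that $D_{t+1}=w$ given $D_t=d$. All terminal (period $T+1$) functions are zero, so $D_{T+1}$ plays no role. States. Generator $i$ has minimum up time $\overline{l}_i\ge1$ and minimum down time $\underline{l}_i\ge1$ (integers), production bounds $b^i_{\min}\le b^i_{\max}$, and ramp up/down amounts $r^i_u,r^i_d$. Its state is $x_t^i=(y_t^i,q_t^i,D_t)$. Here $y_t^i=(\alpha_t^i,\beta_t^i)$ with $\alpha^i_t\in\{0,\ldots,\overline{l}_i\}$, $\beta^i_t\in\{0,\ldots,\underline{l}_i\}$, exactly one of them zero (periods on/off, capped), and $q_t^i\in\{0\}\cup[b^i_{\min},b^i_{\max}]$ is the previous production level. The set of such states is $\mathcal{X}_t^i$ for $t\ge2$, and $\mathcal{X}_1^i=\{((0,\underline{l}_i),0,0)\}$. The overall state is $\mathbf{x}_t=(x_t^1,\ldots,x_t^n)\in\mathcal{X}_t$,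 where $\mathcal{X}_t$ consists of tuples with $x_t^i\in\mathcal{X}_t^i$ sharing a common demand component $D_t$. Actions. The action of generator $i$ is $a_t^i=(z_t^i,u_t^i)$, with production $z_t^i\in\mathbb{R}$ for period $t$ and commitment $u_t^i\in\{0,1\}$ for period $t+1$. Let $\underline{u}(y)=1$ if $y=(j,0)$ with $1\le j\le\overline{l}_i$, and $0$ otherwise. Let $\overline{w}(y)=1$ if $y=(1,0)$, and $0$ otherwise. Let $\underline{I}(y)=1$ if $y=(j,0)$ with $1\le j\le\overline{l}_i-1$, and $0$ otherwise. Let $\overline{I}(y)=0$ if $y=(0,j)$ with $1\le j\le\underline{l}_i-1$, and $1$ otherwise. Then $\mathcal{A}_t^i(x_t^i)$ is the set of $(z_t^i,u_t^i)$ with $u_t^i\in\{0,1\}$ satisfying $\underline{u}(y_t^i)b^i_{\min}\le z_t^i\le\underline{u}(y_t^i)b^i_{\max}$; $\underline{I}(y_t^i)\le u_t^i\le\overline{I}(y_t^i)$; $q_t^i-r_d^i-(1-\underline{u}(y_t^i))b^i_{\min}\le z_t^i\le q_t^i+r_u^i+\overline{w}(y_t^i)b^i_{\min}$. Put $\mathcal{A}_t(\mathbf{x}_t)=\times_{i=1}^n\mathcal{A}_t^i(x_t^i)$ (demand constraint relaxed) and $\overline{\mathcal{A}}_t(\mathbf{x}_t)=\{\mathbf{a}_t\in\mathcal{A}_t(\mathbf{x}_t):\sum_{i=1}^n z_t^i=D_t\}$. A minimum over an empty set is $+\infty$. Dynamics. $q_{t+1}^i=z_t^i$, and $y_{t+1}^i$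 equals $(\alpha_t^i+1,0)$ if $0<\alpha_t^i<\overline{l}_i$; $(0,\beta_t^i+1)$ if $0<\beta_t^i<\underline{l}_i$; $(\overline{l}_i,0)$ if $\alpha_t^i=\overline{l}_i,u_t^i=1$; $(0,1)$ if $\alpha_t^i=\overline{l}_i,u_t^i=0$; $(0,\underline{l}_i)$ if $\beta_t^i=\underline{l}_i,u_t^i=0$; $(1,0)$ if $\beta_t^i=\underline{l}_i,u_t^i=1$. The demand component of the next state is $D_{t+1}\sim P_t(\cdot\vert D_t)$. Costs. With real constants $\bar c_i$ (no-load cost), $h_i$ (start-up cost) and a real-valued generation cost $F_t^i$ on $\{0\}\cup[b^i_{\min},b^i_{\max}]$, continuous piecewise linear on $[b^i_{\min},b^i_{\max}]$, set $g_t^i(x_t^i,a_t^i)=H_t^i(y_t^i,u_t^i)+\bar c_iu_t^i+F_t^i(z_t^i)$ for $t\le T-1$, where $H_t^i(y,u)=h_i$ if $y=(0,\underline{l}_i),u=1$ and $0$ otherwise; and $g_T^i(x_T^i,a_T^i)=F_T^i(z_T^i)$. Put $g_t(\mathbf{x}_t,\mathbf{a}_t)=\sum_{i=1}^n g_t^i(x_t^i,a_t^i)$. Original problem. $J_{T+1}=0$ and, for $t=T,\ldots,1$, $J_t(\mathbf{x}_t)=\min_{\mathbf{a}_t\in\overline{\mathcal{A}}_t(\mathbf{x}_t)}\mathbb{E}[g_t(\mathbf{x}_t,\mathbf{a}_t)+J_{t+1}(\mathbf{x}_{t+1})\,\vert\,\mathbf{x}_t,\mathbf{a}_t]$, the expectation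 being over $D_{t+1}\sim P_t(\cdot\vert D_t)$. Thus $J_1(\mathbf{x}_1)$ is the optimal value of minimizing $\mathbb{E}[\sum_{t=1}^T g_t(\mathbf{x}_t,\mathbf{a}_t)]$ over admissible policies satisfying the demand constraints. Summary state. $v_1=0$ and $v_t=\tilde f_t(v_{t-1},D_t)$ for $t\ge2$, for given functions $\tilde f_t$; $v_t$ lies in a finite set $\mathcal{V}_t$. Standing assumption: for all $r>t$, the conditional distribution of $D_r$ given $D_1,\ldots,D_t$ depends only on $v_t$. Lagrangian recursion. $L_{T+1}(\mathbf{x}_{T+1},v_{T+1};\boldsymbol{\lambda})=0$ and, for $t=T,\ldots,1$, $$L_t(\mathbf{x}_t,v_t;\boldsymbol{\lambda})=\min_{\mathbf{a}_t\in\mathcal{A}_t(\mathbf{x}_t)}\mathbb{E}\Big[g_t(\mathbf{x}_t,\mathbf{a}_t)+\lambda_t(v_t)\Big(\sum_{i=1}^n z_t^i-D_t\Big)+L_{t+1}(\mathbf{x}_{t+1},v_{t+1};\boldsymbol{\lambda})\,\Big\vert\,\mathbf{x}_t,v_t,\mathbf{a}_t\Big],$$ where the expectation is over $D_{t+1}\sim P_t(\cdot\vert D_t)$. $\boldsymbol{\lambda}$ is regarded as an element of the finite-dimensional vector space $\prod_{t=1}^T\mathbb{R}^{\mathcal{V}_t}$. *)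

(* Defs.v *)
(* MathComp / MathComp-Analysis *)
From mathcomp Require Import all_boot all_order all_algebra finmap.
From mathcomp Require Import all_classical all_reals all_analysis.
Import Order.TTheory GRing.Theory Num.Theory.
Import numFieldNormedType.Exports.

Set Implicit Arguments.
Unset Strict Implicit.
Unset Printing Implicit Defensive.

Local Open Scope classical_set_scope.
Local Open Scope ring_scope.

(* Periods are the naturals 1, ..., T; the values at other indices of families
   over nat are irrelevant. *)

Definition piecewise_linear (R : realType) (a b : R) (f : R -> R) : Prop :=
  exists s : seq R, itv_partition a b s /\
    forall k, (k < size s)%N ->
      exists m c : R, forall z, nth b (a :: s) k < z < nth b s k ->
        f z = m * z + c.

Section Generators.
Variable R : realType.

Record generator := Generator {
  min_up : nat;
  min_down : nat;
  bmin : R;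
  bmax : R;
  ramp_up : R;
  ramp_down : R;
  no_load : R;
  start_up : R;
  (* F_t; only its values on {0} `|` [bmin, bmax] are ever used *)
  gen_cost : nat -> R -> R
}.

Record generator_ok (T : nat) (G : generator) : Prop := GeneratorOk {
  min_up_ge1 : (1 <= min_up G)%N;
  min_down_ge1 : (1 <= min_down G)%N;
  bmin_le_bmax : bmin G <= bmax G;
  gen_cost_continuous : forall t, (1 <= t <= T)%N ->
    {within `[bmin G, bmax G], continuous (gen_cost G t)};
  gen_cost_pwl : forall t, (1 <= t <= T)%N ->
    piecewise_linear (bmin G) (bmax G) (gen_cost G t)
}.

(* (alpha, beta) = (periods on, periods off), capped *)
Definition status : Type := (nat * nat)%type.

(* The part (y, q) of a generator's state that is not shared: the demand
   component, common to all generators, is stored once in [state] below. *)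
Record unit_state := UnitState { ustatus : status; uprod : R }.

Record unit_action := UnitAction { uoutput : R; ucommit : bool }.

Implicit Types (G : generator) (y : status) (x : unit_state) (a : unit_action).

Definition unit_states G (t : nat) : set unit_state :=
  if t == 1%N then [set UnitState (0%N, min_down G) 0]
  else [set x | let: (al, be) := ustatus x in
    [/\ (al <= min_up G)%N, (be <= min_down G)%N,
        (al == 0%N) (+) (be == 0%N) &
        uprod x = 0 \/ bmin G <= uprod x <= bmax G]].

Definition is_on G y : bool := (1 <= y.1 <= min_up G)%N && (y.2 == 0%N).
Definition just_on y : bool := y == (1%N, 0%N).
Definition must_on G y : bool := (1 <= y.1 <= (min_up G).-1)%N && (y.2 == 0%N).
Definition may_on G y : bool :=
  ~~ ((y.1 == 0%N) && (1 <= y.2 <= (min_down G).-1)%N).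

Definition unit_actions G x : set unit_action :=
  [set a | let: UnitState y q := x in let: UnitAction z u := a in
    [/\ (is_on G y)%:R * bmin G <= z <= (is_on G y)%:R * bmax G,
        (must_on G y <= u <= may_on G y)%N &
        q - ramp_down G - (1 - (is_on G y)%:R) * bmin G <= z
          <= q + ramp_up G + (just_on y)%:R * bmin G]].

Definition next_status G y (u : bool) : status :=
  let: (al, be) := y in
  if (0 < al < min_up G)%N then (al.+1, 0%N)
  else if (0 < be < min_down G)%N then (0%N, be.+1)
  else if al == min_up G then (if u then (min_up G, 0%N) else (0%N, 1%N))
  (* on legitimate statuses, only be = min_down G is left *)
  else (if u then (1%N, 0%N) else (0%N, min_down G)).

Definition next_unit G x a : unit_state :=
  UnitState (next_status G (ustatus x) (ucommit a)) (uoutput a).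

Definition switch_cost G y (u : bool) : R :=
  if (y == (0%N, min_down G)) && u then start_up G else 0.

Definition unit_cost (T : nat) G (t : nat) x a : R :=
  if (t < T)%N then
    switch_cost G (ustatus x) (ucommit a) + no_load G * (ucommit a)%:R
    + gen_cost G t (uoutput a)
  else gen_cost G t (uoutput a).

End Generators.

Section Problem.
Variables (R : realType) (n : nat).

Record problem := Problem {
  horizon : nat;
  gens : 'I_n -> generator R;
  dvals : nat -> {fset R};
  (* dtrans t d w = P_t(w | d) *)
  dtrans : nat -> R -> R -> R
}.

Record state := State { units : 'I_n -> unit_state R; demand : R }.
Definition action : Type := 'I_n -> unit_action R.

Variable pb : problem.
Local Notation T := (horizon pb).

Definition states (t : nat) : set state :=
  [set x | (forall i, unit_states (gens pb i) t (units x i)) /\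
           demand x \in dvals pb t].

Definition relaxed_actions (x : state) : set action :=
  [set a | forall i, unit_actions (gens pb i) (units x i) (a i)].

Definition total_output (a : action) : R := \sum_(i < n) uoutput (a i).

Definition feasible_actions (x : state) : set action :=
  relaxed_actions x `&` [set a | total_output a = demand x].

Definition stage_cost (t : nat) (x : state) (a : action) : R :=
  \sum_(i < n) unit_cost T (gens pb i) t (units x i) (a i).

Definition next_state (x : state) (a : action) (w : R) : state :=
  State (fun i => next_unit (gens pb i) (units x i) (a i)) w.

(* E[f(D_{t+1})] for D_{t+1} ~ P_t(. | d); note that 0 * +oo = 0 in \bar R *)
Definition expect_next (t : nat) (d : R) (f : R -> \bar R) : \bar R :=
  (\sum_(w <- dvals pb t.+1) (dtrans pb t d w)%:E * f w)%E.

(* [cost_to_go k t] is J_t when k periods t, ..., t + k - 1 remain.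
   The minimum is written as the infimum in \bar R: the same value when it is
   attained, and +oo over an empty set. *)
Fixpoint cost_to_go (k t : nat) (x : state) : \bar R :=
  if k is k'.+1 then
    ereal_inf [set expect_next t (demand x) (fun w =>
        ((stage_cost t x a)%:E + cost_to_go k' t.+1 (next_state x a w))%E)
      | a in feasible_actions x]
  else 0%E.

Definition J (t : nat) (x : state) : \bar R := cost_to_go (T.+1 - t) t x.

(* The label sets V_t of the summary state; [sum_init] is the initial value
   v_1 = 0, and [sum_next t] is the update giving v_{t+1} from v_t and
   D_{t+1}. *)
Record summary := Summary {
  sumval : nat -> finType;
  sum_init : sumval 1;
  sum_next : forall t, sumval t -> R -> sumval t.+1
}.

Variable S : summary.

(* The finite-dimensional space of multipliers: the coordinate indexed by
   (s, v), with v in V_{s+1}, is lambda_{s+1}(v), for the periods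
   s + 1 = 1, ..., T. *)
Definition multipliers : Type :=
  {ffun {s : 'I_T & sumval S s.+1} -> R^o}.

(* lambda_t(v), with the junk value 0 outside of 1 <= t <= T *)
Definition mult_at (lam : multipliers) (t : nat) : sumval S t -> R :=
  match t with
  | 0 => fun _ => 0
  | s.+1 => fun v =>
      match @idP (s < T)%N with
      | ReflectT lt_sT =>
          lam (Tagged (fun r : 'I_T => sumval S r.+1) (i := Ordinal lt_sT) v)
      | ReflectF _ => 0
      end
  end.

Fixpoint lagrangian_to_go (lam : multipliers) (k t : nat) (x : state)
    (v : sumval S t) : \bar R :=
  if k is k'.+1 then
    ereal_inf [set expect_next t (demand x) (fun w =>
        ((stage_cost t x a
          + mult_at lam v * (total_output a - demand x))%:E
         + lagrangian_to_go lam k' (next_state x a w) (sum_next v w))%E)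
      | a in relaxed_actions x]
  else 0%E.

Definition L (lam : multipliers) (t : nat) (x : state) (v : sumval S t) :
  \bar R := lagrangian_to_go lam (T.+1 - t) x v.

(* [summary_of d s] is v_{s+1} along the demand path d_1, d_2, ... *)
Fixpoint summary_of (d : nat -> R) (s : nat) : sumval S s.+1 :=
  match s with
  | 0 => sum_init S
  | r.+1 => sum_next (summary_of d r) (d r.+2)
  end.

End Problem.

Section DemandProcess.
Variables (R : realType) (n : nat) (pb : problem R n) (S : summary R).
Variables (disp : measure_display) (Omega : measurableType disp).
Variables (Pr : probability Omega R) (D : nat -> {RV Pr >-> R}).
Local Notation T := (horizon pb).

Definition cprob (A B : set Omega) : R := fine (Pr (A `&` B)) / fine (Pr B).

(* {D_1 = d_1, ..., D_t = d_t} *)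
Definition history (t : nat) (d : nat -> R) : set Omega :=
  [set om | forall r, (1 <= r <= t)%N -> D r om = d r].

Record markov_demand : Prop := MarkovDemand {
  dvals1 : dvals pb 1 = [fset 0]%fset;
  demand_values : forall t om, (1 <= t <= T)%N -> D t om \in dvals pb t;
  dtrans_ge0 : forall t d w, (1 <= t <= T)%N ->
    d \in dvals pb t -> w \in dvals pb t.+1 -> 0 <= dtrans pb t d w;
  (* for t = T this concerns a dummy D_{T+1}, on which nothing depends *)
  dtrans_sum1 : forall t d, (1 <= t <= T)%N -> d \in dvals pb t ->
    \sum_(w <- dvals pb t.+1) dtrans pb t d w = 1;
  demand_markov : forall t (d : nat -> R) w, (1 <= t < T)%N ->
    Pr (history t d) != 0%E -> w \in dvals pb t.+1 ->
    cprob [set om | D t.+1 om = w] (history t d) = dtrans pb t (d t) w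
}.

(* With t = s + 1: for every r > t, the conditional law of D_r given
   D_1, ..., D_t is a function of v_t. *)
Definition summary_sufficient : Prop :=
  forall (s r : nat) (d d' : nat -> R), (s.+1 < r <= T)%N ->
    Pr (history s.+1 d) != 0%E -> Pr (history s.+1 d') != 0%E ->
    summary_of S d s = summary_of S d' s ->
    forall w, cprob [set om | D r om = w] (history s.+1 d) =
              cprob [set om | D r om = w] (history s.+1 d').

End DemandProcess.

(* For functions with values in R or +oo; the values +oo come from minima over
   empty action sets. *)
Definition concave_ereal (R : realType) (E : lmodType R) (f : E -> \bar R) :
    Prop :=
  forall (p : R) (u v : E), 0 <= p <= 1 ->
    (p%:E * f u + (1 - p)%:E * f v <= f (p *: u + (1 - p) *: v)%R)%E.

(* Main.v *)
(* Backward induction on the periods. For (1), a feasible action is also a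
   relaxed action and its penalty term vanishes. For (2), the penalty is linear
   in the multipliers, and concavity passes to nonnegative combinations and to
   infima over an action set that does not depend on the multipliers. Neither
   step needs the values to be finite: multiplication by a nonnegative real
   distributes over addition in \bar R even for +oo + -oo = -oo. *)
Require Import Defs.
From mathcomp Require Import all_boot all_order all_algebra finmap.
From mathcomp Require Import all_classical all_reals all_analysis.
From mathcomp Require Import ring.
Import Order.TTheory GRing.Theory Num.Theory.

Section ExtendedReals.
Context {R : realType}.
Local Open Scope ereal_scope.

(** For [p = 0] every product is 0, even with an infinite factor; for [p > 0] multiplication fixes
    both infinities, so the convention for [+oo + -oo] acts alike on both sides. *)
Lemma nneg_muleDr (p : R) (a b : \bar R) :
  (0 <= p)%R -> p%:E * (a + b) = p%:E * a + p%:E * b.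
Proof.
rewrite le_eqVlt => /predU1P[<-|p0]; first by rewrite !mul0e adde0.
have [py pNy] : p%:E * +oo = +oo /\ p%:E * -oo = -oo.
  by rewrite gt0_muley ?gt0_muleNy ?lte_fin.
by case: a b => [a| |] [b| |];
  rewrite /= ?py ?pNy -?EFinM -?EFinD -?EFinM ?mulrDr //= ?py ?pNy.
Qed.

Lemma nneg_mule_sumr (p : R) (I : Type) (s : seq I) (f : I -> \bar R) :
  (0 <= p)%R -> p%:E * (\sum_(i <- s) f i) = \sum_(i <- s) p%:E * f i.
Proof.
move=> p0; elim: s => [|i s IHs]; first by rewrite !big_nil mule0.
by rewrite !big_cons nneg_muleDr // IHs.
Qed.

(** Each [f a] at the mixed point dominates the mixture of its own values, hence that of the infima.
    An empty [X] needs no separate case. *)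
Lemma concave_ereal_inf (E : lmodType R) (A : Type) (X : set A)
    (f : A -> E -> \bar R) :
  (forall a, X a -> concave_ereal (f a)) ->
  concave_ereal (fun l => ereal_inf [set f a l | a in X]).
Proof.
move=> fC p u v p01; apply: le_ereal_inf_tmp => _ [a Xa <-].
apply: le_trans (fC a Xa p u v p01); move: p01 => /andP[p0 p1].
by apply: leeD; apply: lee_wpmul2l; rewrite ?lee_fin ?subr_ge0 //;
  apply: ereal_inf_lbound; exists a.
Qed.

Lemma concave_ereal_sum (E : lmodType R) (I : eqType) (s : seq I) (c : I -> R)
    (f : I -> E -> \bar R) :
  (forall i, i \in s -> (0 <= c i)%R) ->
  (forall i, i \in s -> concave_ereal (f i)) ->
  concave_ereal (fun l => \sum_(i <- s) (c i)%:E * f i l).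
Proof.
move=> c0 fC p u v p01; have /andP[p0 p1] := p01.
rewrite !nneg_mule_sumr ?subr_ge0 // -big_split /=.
rewrite big_seq [leRHS]big_seq; apply: lee_sum => i si.
(* Pull the weight [c i] outside the convex combination. *)
rewrite !(muleCA _ (c i)%:E) -nneg_muleDr ?c0 //.
by apply: lee_wpmul2l; rewrite ?lee_fin ?c0 // fC.
Qed.

(** Meant for [h] the stage cost plus penalty and [f] the continuation value. *)
Lemma concave_ereal_affineD (E : lmodType R) (h : E -> R) (f : E -> \bar R) :
  (forall p u v, h (p *: u + (1 - p) *: v)%R = (p * h u + (1 - p) * h v)%R) ->
  concave_ereal f -> concave_ereal (fun l => (h l)%:E + f l).
Proof.
move=> hA fC p u v p01; have /andP[p0 p1] := p01.
rewrite !nneg_muleDr ?subr_ge0 // addeACA hA (EFinD (p * h u)) !EFinM.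
by apply: leeD => //; apply: fC.
Qed.

End ExtendedReals.

Section WeakDuality.
Context {R : realType} {n : nat} {pb : problem R n} {S : summary R}.

Hypothesis dtrans_ge0 : forall t d w, (1 <= t <= horizon pb)%N ->
  d \in dvals pb t -> w \in dvals pb t.+1 -> (0 <= dtrans pb t d w)%R.

Lemma le_expect_next (t : nat) (d : R) (f g : R -> \bar R) :
  (1 <= t <= horizon pb)%N -> d \in dvals pb t ->
  (forall w, w \in dvals pb t.+1 -> (f w <= g w)%E) ->
  (expect_next pb t d f <= expect_next pb t d g)%E.
Proof.
move=> tT dt fg; rewrite /expect_next big_seq [leRHS]big_seq.
apply: lee_sum => w wt; apply: lee_wpmul2l; last exact: fg.
by rewrite lee_fin dtrans_ge0.
Qed.

Lemma mult_at_affine (t : nat) (v : sumval S t) (p : R)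
    (l m : multipliers pb S) :
  mult_at (p *: l + (1 - p) *: m)%R v =
  (p * mult_at l v + (1 - p) * mult_at m v)%R.
Proof.
case: t v => [|s] v /=; first by rewrite !mulr0 addr0.
(* Within the horizon the operations are coordinatewise; beyond it all three values are the junk
   0. *)
by case: {-}_ / idP => sT; rewrite ?ffunE ?mulr0 ?addr0.
Qed.

(** The equation on [k] and [t] keeps [t] within the horizon whenever a period remains, so that the
    transition weights are nonnegative. *)
Lemma lagrangian_le_cost_to_go (lam : multipliers pb S) (k t : nat)
    (x : state R n) (v : sumval S t) :
  (0 < t)%N -> (k + t = (horizon pb).+1)%N -> demand x \in dvals pb t ->
  (lagrangian_to_go lam k x v <= cost_to_go pb k t x)%E.
Proof.
elim: k t x v => [//|k IHk] t x v t0 ktT xt /=.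
apply: le_ereal_inf_tmp => _ [a [aA aD] <-].
(* The Lagrangian value of the same action [a], written without the penalty that [aD] cancels. *)
apply: ge_ereal_inf; exists (expect_next pb t (demand x) (fun w =>
  ((stage_cost pb t x a)%:E
   + lagrangian_to_go lam k (next_state pb x a w) (sum_next v w))%E)).
  by exists a => //; rewrite aD subrr mulr0 addr0.
apply: le_expect_next => // [|w wt].
  by rewrite t0 -ltnS -ktT addSn ltnS leq_addl.
by apply: leeD => //; apply: IHk; rewrite // addnS -ktT.
Qed.

Lemma lagrangian_to_go_concave (k t : nat) (x : state R n) (v : sumval S t) :
  (0 < t)%N -> (k + t = (horizon pb).+1)%N -> demand x \in dvals pb t ->
  concave_ereal (fun lam : multipliers pb S => lagrangian_to_go lam k x v).
Proof.
elim: k t x v => [|k IHk] t x v t0 ktT xt /=.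
  by move=> p l m _; rewrite !mule0 adde0.
apply: concave_ereal_inf => a _; apply: concave_ereal_sum => w wt.
  by apply: dtrans_ge0 => //; rewrite t0 -ltnS -ktT addSn ltnS leq_addl.
apply: concave_ereal_affineD; last by apply: IHk; rewrite // addnS -ktT.
(* The stage cost is constant in the multipliers and survives because the weights sum to 1. *)
by move=> p l m; rewrite mult_at_affine; ring.
Qed.

End WeakDuality.

Theorem theorem4 (R : realType) (n : nat) (pb : problem R n) (S : summary R)
    (disp : measure_display) (Omega : measurableType disp)
    (Pr : probability Omega R) (D : nat -> {RV Pr >-> R})
    (hgens : forall i, generator_ok (horizon pb) (gens pb i))
    (hD : markov_demand pb D)
    (hS : summary_sufficient pb S D)
    (x1 : state R n) (hx1 : states pb 1 x1) :
  (forall lam : multipliers pb S,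
     (L lam x1 (sum_init S) <= J pb 1 x1)%E) /\
  concave_ereal (fun lam : multipliers pb S => L lam x1 (sum_init S)).
Proof.
have [_ x1D] := hx1.
(* The counting invariant of both inductions, at period 1. *)
have periods : ((horizon pb).+1 - 1 + 1 = (horizon pb).+1)%N by rewrite subnK.
have dtrans0 := dtrans_ge0 hD.
split; first by move=> lam; apply: lagrangian_le_cost_to_go.
exact: lagrangian_to_go_concave.
Qed.
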